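(* The only power means that are normal are the arithmetic mean $A(x,y)=\frac{x+y}{2}$, the geometric mean $G(x,y)=\sqrt{xy}$, and the harmonic mean $H(x,y)=\frac{2xy}{x+y}$. That is, a power mean $\pi_r$ ($r\in\mathbb{R}$) is normal if and only if it is one of $A$, $G$, $H$.
   Context: All functions are defined for $x,y>0$. The power means are $\pi_r(x,y)=\left(\frac{x^r+y^r}{2}\right)^{1/r}$ for $r\in\mathbb{R}\setminus\{0\}$, and $\pi_0:=G$, $G(x,y)=\sqrt{xy}$. A mean is a function $M:(0,+\infty)^2\to(0,+\infty)$ of class $C^\infty$ such that $\min(x,y)\le M(x,y)\le\max(x,y)$ and $M(x,y)=M(y,x)$ for all $x,y>0$. A mean $M$ is normal if there is a positive infinitely differentiable function $P$ on $(0,+\infty)$ such that $M(x,y)=\frac{xP(x)+yP(y)}{P(x)+P(y)}$ for all $x,y>0$. *)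

(* Defs.v *)
From Stdlib Require Import Reals.
From Coquelicot Require Import Coquelicot.
Open Scope R_scope.

(* Functions on (0,+oo) and (0,+oo)^2 are represented by total functions on
   R and R * R; only their values at positive arguments are ever constrained
   or compared. *)

Definition agree_pos (M N : R -> R -> R) : Prop :=
  forall x y : R, 0 < x -> 0 < y -> M x y = N x y.

Definition smooth_pos (P : R -> R) : Prop :=
  forall (n : nat) (x : R), 0 < x -> ex_derive_n P n x.

(* [ex_diff_n M n x y]: M and its iterated partial derivatives at (x, y), in
   every order of differentiation and up to total order n, exist and are
   jointly continuous. *)
Definition smooth2_pos (M : R -> R -> R) : Prop :=
  forall (n : nat) (x y : R), 0 < x -> 0 < y -> ex_diff_n M n x y.

Definition is_mean (M : R -> R -> R) : Prop :=
  smooth2_pos M /\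
  forall x y : R, 0 < x -> 0 < y ->
    Rmin x y <= M x y <= Rmax x y /\ M x y = M y x.

Definition is_normal_mean (M : R -> R -> R) : Prop :=
  is_mean M /\
  exists P : R -> R,
    (forall x : R, 0 < x -> 0 < P x) /\ smooth_pos P /\
    forall x y : R, 0 < x -> 0 < y ->
      M x y = (x * P x + y * P y) / (P x + P y).

Definition arithmetic_mean (x y : R) : R := (x + y) / 2.
Definition geometric_mean (x y : R) : R := sqrt (x * y).
Definition harmonic_mean (x y : R) : R := 2 * x * y / (x + y).

Definition power_mean (r : R) (x y : R) : R :=
  if Req_dec_T r 0 then geometric_mean x y
  else Rpower ((Rpower x r + Rpower y r) / 2) (1 / r).

(* Main.v *)
Require Import Defs.
From Stdlib Require Import Reals Lra Lia.
From Coquelicot Require Import Coquelicot.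
Open Scope R_scope.

(** Write [M_r] for [power_mean r].  The harmonic, geometric and arithmetic means
    are [M_(-1)], [M_0] and [M_1], and they are normal with weights [1/x],
    [1/sqrt x] and [1].  Each of them is a monomial [k * x^a * y^b * (x+y)^c]
    with real exponents, and sums of such monomials are closed under both partial
    derivatives, which gives their smoothness ([monomial_smooth2]).

    Conversely, suppose that [M_r] is normal with weight [P].  If [r < 0], then
    [M_(-r)(x,y) = 1 / M_r(1/x,1/y)] satisfies the same kind of equation with
    weight [P(1/x)/x] ([power_mean_dual]); so let [r > 0].  Solving the equation
    at [(1,s)] gives [P s / P 1 = (1 - M_r(1,s)) / (M_r(1,s) - s)] for
    [0 < s < 1] ([weight_ratio]), and the homogeneity of [M_r] forces
    [P s ^ 2 = P 1 * P (s^2)] ([weight_square]).  When [s] tends to [0],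
    [M_r(1,s)] tends to [m = 2^(-1/r) < 1], hence [P s / P 1] tends to the
    positive number [q = (1 - m) / m] ([weight_ratio_lim]).  The square relation
    passes to the limit as [q^2 = q], so [q = 1], [m = 1/2] and [r = 1]
    ([positive_exponent_one]). *)

(** * Smoothness *)

Lemma Rpower_pos (x a : R) : 0 < Rpower x a.
Proof. apply exp_pos. Qed.

Lemma locally_pos (x : R) : 0 < x -> locally x (fun t => 0 < t).
Proof. intros Hx. apply (open_gt 0 x Hx). Qed.

Lemma locally_2d_pos (x y : R) :
  0 < x -> 0 < y -> locally_2d (fun u v => 0 < u /\ 0 < v) x y.
Proof.
  intros Hx Hy. exists (mkposreal _ (Rmin_pos x y Hx Hy)). simpl. intros u v Hu Hv.
  pose proof (Rmin_l x y). pose proof (Rmin_r x y).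
  apply Rabs_def2 in Hu. apply Rabs_def2 in Hv. lra.
Qed.

Lemma is_derive_Rpower (x a : R) :
  0 < x -> is_derive (fun z => Rpower z a) x (a * Rpower x (a - 1)).
Proof. intros Hx. apply is_derive_Reals, derivable_pt_lim_power, Hx. Qed.

Lemma is_derive_Rpower_shift_l (x y c : R) :
  0 < x + y ->
  is_derive (fun z => Rpower (z + y) c) x (c * Rpower (x + y) (c - 1)).
Proof.
  intros H.
  replace (c * Rpower (x + y) (c - 1)) with (1 * (c * Rpower (x + y) (c - 1))) by ring.
  apply (is_derive_comp (fun t => Rpower t c) (fun z => z + y)).
  - now apply is_derive_Rpower.
  - auto_derive; [easy | ring].
Qed.

(** All derivatives keep the form [c * x^b], which is what the induction needs. *)
Lemma smooth_pos_Rpower (a : R) : smooth_pos (fun x => Rpower x a).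
Proof.
  assert (HD : forall n, exists c b, forall x, 0 < x ->
             Derive_n (fun x => Rpower x a) n x = c * Rpower x b).
  { induction n as [|n [c [b IH]]].
    - exists 1, a. intros x _. simpl. ring.
    - exists (c * b), (b - 1). intros x Hx. simpl.
      rewrite (Derive_ext_loc _ (fun z => c * Rpower z b)).
      + apply is_derive_unique. rewrite Rmult_assoc.
        apply is_derive_scal, is_derive_Rpower, Hx.
      + generalize (locally_pos x Hx). apply filter_imp. exact IH. }
  intros [|n] x Hx; [exact I|]. destruct (HD n) as [c [b H]].
  apply (ex_derive_ext_loc (fun z => c * Rpower z b)).
  - generalize (locally_pos x Hx). apply filter_imp. intros t Ht. now rewrite H.
  - eexists. apply is_derive_scal, is_derive_Rpower, Hx.
Qed.

Definition monomial (k a b c x y : R) : R :=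
  k * (Rpower x a * Rpower y b * Rpower (x + y) c).

(** The third factor makes the class contain the harmonic mean; the closure
    under sums is what the product rule requires. *)
Inductive monomial_sum : (R -> R -> R) -> Prop :=
| monomial_sum_monomial k a b c : monomial_sum (monomial k a b c)
| monomial_sum_plus f g :
    monomial_sum f -> monomial_sum g -> monomial_sum (fun x y => f x y + g x y).

Lemma monomial_sum_derive_l f :
  monomial_sum f ->
  exists g, monomial_sum g /\
    forall x y, 0 < x -> 0 < y -> is_derive (fun z => f z y) x (g x y).
Proof.
  induction 1 as [k a b c | f1 f2 _ [g1 [Hg1 D1]] _ [g2 [Hg2 D2]]].
  - exists (fun x y => monomial (k * a) (a - 1) b c x y
                       + monomial (k * c) a b (c - 1) x y).
    split; [apply monomial_sum_plus; apply monomial_sum_monomial|].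
    intros x y Hx Hy. unfold monomial.
    evar_last.
    + apply is_derive_scal. apply (is_derive_mult (fun z => Rpower z a * Rpower y b)).
      * apply (is_derive_mult (fun z => Rpower z a) (fun _ => Rpower y b)).
        -- now apply is_derive_Rpower.
        -- apply @is_derive_const.
        -- intros; apply Rmult_comm.
      * apply is_derive_Rpower_shift_l. lra.
      * intros; apply Rmult_comm.
    + unfold plus, mult, zero; simpl. ring.
  - exists (fun x y => g1 x y + g2 x y). split; [now apply monomial_sum_plus|].
    intros x y Hx Hy. apply @is_derive_plus; auto.
Qed.

Lemma monomial_sum_swap f :
  monomial_sum f -> exists g, monomial_sum g /\ forall x y, f x y = g y x.
Proof.
  induction 1 as [k a b c | f1 f2 _ [g1 [Hg1 E1]] _ [g2 [Hg2 E2]]].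
  - exists (monomial k b a c). split; [apply monomial_sum_monomial|].
    intros x y. unfold monomial. rewrite (Rplus_comm y x). ring.
  - exists (fun x y => g1 x y + g2 x y). split; [now apply monomial_sum_plus|].
    intros x y. now rewrite E1, E2.
Qed.

Lemma monomial_sum_derive_r f :
  monomial_sum f ->
  exists g, monomial_sum g /\
    forall x y, 0 < x -> 0 < y -> is_derive (fun z => f x z) y (g x y).
Proof.
  intros Hf. destruct (monomial_sum_swap f Hf) as [f' [Hf' E]].
  destruct (monomial_sum_derive_l f' Hf') as [g' [Hg' D]].
  destruct (monomial_sum_swap g' Hg') as [g [Hg E']].
  exists g. split; [exact Hg|]. intros x y Hx Hy. rewrite <- E'.
  apply (is_derive_ext (fun z => f' z x)); [intros t; now rewrite E | auto].
Qed.

Lemma monomial_sum_continuous f :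
  monomial_sum f -> forall x y, 0 < x -> 0 < y -> continuity_2d_pt f x y.
Proof.
  assert (HC : forall t a, 0 < t -> continuity_pt (fun z => Rpower z a) t).
  { intros t a Ht. apply derivable_continuous_pt.
    eexists. now apply derivable_pt_lim_power. }
  induction 1 as [k a b c | f1 f2 _ IH1 _ IH2]; intros x y Hx Hy.
  - unfold monomial.
    apply (continuity_2d_pt_mult (fun _ _ => k)); [apply continuity_2d_pt_const|].
    apply (continuity_2d_pt_mult (fun u v => Rpower u a * Rpower v b)).
    + apply (continuity_2d_pt_mult (fun u _ => Rpower u a)).
      * apply (continuity_1d_2d_pt_comp (fun z => Rpower z a) (fun u _ => u)); [auto|].
        apply continuity_2d_pt_id1.
      * apply (continuity_1d_2d_pt_comp (fun z => Rpower z b) (fun _ v => v)); [auto|].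
        apply continuity_2d_pt_id2.
    + apply (continuity_1d_2d_pt_comp (fun z => Rpower z c) (fun u v => u + v)).
      * apply HC; lra.
      * apply continuity_2d_pt_plus; [apply continuity_2d_pt_id1|].
        apply continuity_2d_pt_id2.
  - apply continuity_2d_pt_plus; auto.
Qed.

Lemma smooth2_pos_agree M N : agree_pos M N -> smooth2_pos N -> smooth2_pos M.
Proof.
  intros E HN n x y Hx Hy. apply (ex_diff_n_ext_loc N); [|now apply HN].
  apply locally_2d_impl with (2 := locally_2d_pos x y Hx Hy).
  apply locally_2d_forall. intros u v [Hu Hv]. symmetry. now apply E.
Qed.

(** The induction on the order runs over all [f] in the class at once: the
    partial derivatives agree with members of the class only on the positive
    quadrant, which is open, and smoothness is local. *)
Lemma monomial_sum_smooth2 f : monomial_sum f -> smooth2_pos f.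
Proof.
  intros Hf n. revert f Hf.
  induction n as [|n IH]; intros f Hf x y Hx Hy; split;
    try (now apply monomial_sum_continuous); [exact I|].
  destruct (monomial_sum_derive_l f Hf) as [g [Hg Dg]].
  destruct (monomial_sum_derive_r f Hf) as [h [Hh Dh]].
  repeat split.
  - eexists; now apply Dg.
  - eexists; now apply Dh.
  - apply (ex_diff_n_ext_loc g); [|now apply IH].
    apply locally_2d_impl with (2 := locally_2d_pos x y Hx Hy).
    apply locally_2d_forall. intros u v [Hu Hv]. symmetry.
    apply is_derive_unique. now apply Dg.
  - apply (ex_diff_n_ext_loc h); [|now apply IH].
    apply locally_2d_impl with (2 := locally_2d_pos x y Hx Hy).
    apply locally_2d_forall. intros u v [Hu Hv]. symmetry.
    apply is_derive_unique. now apply Dh.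
Qed.

Lemma monomial_smooth2 k a b c : smooth2_pos (monomial k a b c).
Proof. apply monomial_sum_smooth2, monomial_sum_monomial. Qed.

(** * Weighted means *)

(** Normality stripped of smoothness, so that it transfers by algebra alone
    between an exponent and its opposite. *)
Definition weighted_by (P : R -> R) (M : R -> R -> R) : Prop :=
  (forall x, 0 < x -> 0 < P x) /\
  forall x y, 0 < x -> 0 < y -> M x y = (x * P x + y * P y) / (P x + P y).

Lemma weighted_by_is_mean P M : smooth2_pos M -> weighted_by P M -> is_mean M.
Proof.
  intros HS [HP HM]. split; [exact HS|]. intros x y Hx Hy.
  pose proof (HP x Hx) as Px. pose proof (HP y Hy) as Py.
  pose proof (Rmin_l x y). pose proof (Rmin_r x y).
  pose proof (Rmax_l x y). pose proof (Rmax_r x y).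
  rewrite (HM x y), (HM y x) by assumption. repeat split.
  - apply Rle_div_r; [lra|]. nra.
  - apply Rle_div_l; [lra|]. nra.
  - field. lra.
Qed.

Lemma weighted_monomial_normal M k a b c d :
  agree_pos M (monomial k a b c) ->
  weighted_by (fun x => Rpower x d) M ->
  is_normal_mean M.
Proof.
  intros E HW. split.
  - apply weighted_by_is_mean with (2 := HW).
    apply smooth2_pos_agree with (1 := E), monomial_smooth2.
  - exists (fun x => Rpower x d). destruct HW as [HP HM].
    split; [exact HP | split; [apply smooth_pos_Rpower | exact HM]].
Qed.

Lemma Rpower_m1 x : 0 < x -> Rpower x (-1) = / x.
Proof. intros Hx. change (-1) with (- (1)). now rewrite Rpower_Ropp, Rpower_1. Qed.

Lemma normal_arithmetic M : agree_pos M arithmetic_mean -> is_normal_mean M.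
Proof.
  intros E. apply (weighted_monomial_normal M (/ 2) 0 0 1 0).
  - intros x y Hx Hy. rewrite E by assumption. unfold monomial, arithmetic_mean.
    rewrite !Rpower_O, Rpower_1 by lra. field.
  - split; [intros; apply Rpower_pos|]. intros x y Hx Hy. rewrite E by assumption.
    unfold arithmetic_mean. rewrite !Rpower_O by assumption. field.
Qed.

Lemma normal_geometric M : agree_pos M geometric_mean -> is_normal_mean M.
Proof.
  intros E. apply (weighted_monomial_normal M 1 (/ 2) (/ 2) 0 (- / 2)).
  - intros x y Hx Hy. rewrite E by assumption. unfold monomial, geometric_mean.
    rewrite !Rpower_sqrt, Rpower_O, sqrt_mult by lra. ring.
  - split; [intros; apply Rpower_pos|]. intros x y Hx Hy. rewrite E by assumption.
    unfold geometric_mean. rewrite !Rpower_Ropp, !Rpower_sqrt, sqrt_mult by lra.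
    pose proof (sqrt_lt_R0 x Hx). pose proof (sqrt_lt_R0 y Hy).
    rewrite <- (sqrt_sqrt x) at 2 by lra. rewrite <- (sqrt_sqrt y) at 2 by lra.
    field. repeat split; lra.
Qed.

Lemma normal_harmonic M : agree_pos M harmonic_mean -> is_normal_mean M.
Proof.
  intros E. apply (weighted_monomial_normal M 2 1 1 (-1) (-1)).
  - intros x y Hx Hy. rewrite E by assumption. unfold monomial, harmonic_mean.
    rewrite !Rpower_m1, !Rpower_1 by lra. field. lra.
  - split; [intros; apply Rpower_pos|]. intros x y Hx Hy. rewrite E by assumption.
    unfold harmonic_mean. rewrite !Rpower_m1 by assumption. field. lra.
Qed.

(** * Power means *)

Lemma power_mean_nonzero r x y :
  r <> 0 -> power_mean r x y = Rpower ((Rpower x r + Rpower y r) / 2) (1 / r).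
Proof. intros Hr. unfold power_mean. now destruct (Req_dec_T r 0). Qed.

Lemma power_mean_arithmetic : agree_pos (power_mean 1) arithmetic_mean.
Proof.
  intros x y Hx Hy. rewrite power_mean_nonzero by lra.
  replace (1 / 1) with 1 by field.
  rewrite (Rpower_1 x), (Rpower_1 y) by assumption. apply Rpower_1. unfold arithmetic_mean. lra.
Qed.

Lemma power_mean_geometric : agree_pos (power_mean 0) geometric_mean.
Proof.
  intros x y Hx Hy. unfold power_mean.
  destruct (Req_dec_T 0 0) as [_|H]; [reflexivity | now destruct H].
Qed.

Lemma power_mean_harmonic : agree_pos (power_mean (-1)) harmonic_mean.
Proof.
  intros x y Hx Hy. rewrite power_mean_nonzero by lra.
  replace (1 / -1) with (-1) by field. rewrite (Rpower_m1 x), (Rpower_m1 y) by assumption.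
  pose proof (Rinv_0_lt_compat x Hx). pose proof (Rinv_0_lt_compat y Hy).
  rewrite Rpower_m1 by lra. unfold harmonic_mean. field. lra.
Qed.

Lemma Rpower_inv_base x r : 0 < x -> Rpower (/ x) r = Rpower x (- r).
Proof. intros Hx. unfold Rpower. rewrite ln_Rinv by assumption. f_equal. ring. Qed.

(** The involution [x -> 1/x] turns a weight [P] into [P(1/x)/x]: the two sums in
    the quotient exchange their roles, because [1/x] times [P(1/x)] is the new
    weight at [x] and [P(1/x)] is [x] times it. *)
Lemma power_mean_dual P r :
  r <> 0 -> weighted_by P (power_mean r) ->
  weighted_by (fun x => P (/ x) / x) (power_mean (- r)).
Proof.
  intros Hr [HP HM]. split.
  - intros x Hx. apply Rdiv_lt_0_compat; [|exact Hx]. now apply HP, Rinv_0_lt_compat.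
  - intros x y Hx Hy.
    pose proof (Rinv_0_lt_compat x Hx) as Hx'. pose proof (Rinv_0_lt_compat y Hy) as Hy'.
    pose proof (HP _ Hx') as Px. pose proof (HP _ Hy') as Py.
    assert (E : power_mean (- r) x y = / power_mean r (/ x) (/ y)).
    { rewrite !power_mean_nonzero by lra. rewrite !Rpower_inv_base by assumption.
      replace (1 / - r) with (- (1 / r)) by (field; lra). apply Rpower_Ropp. }
    rewrite E, HM by assumption.
    field. repeat split; try lra; nra.
Qed.

Lemma power_mean_homogeneous r s x y :
  r <> 0 -> 0 < s -> 0 < x -> 0 < y ->
  power_mean r (s * x) (s * y) = s * power_mean r x y.
Proof.
  intros Hr Hs Hx Hy. rewrite !power_mean_nonzero by assumption.
  pose proof (Rpower_pos x r). pose proof (Rpower_pos y r). pose proof (Rpower_pos s r).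
  rewrite <- !Rpower_mult_distr by assumption.
  replace ((Rpower s r * Rpower x r + Rpower s r * Rpower y r) / 2)
    with (Rpower s r * ((Rpower x r + Rpower y r) / 2)) by field.
  rewrite <- Rpower_mult_distr by lra. f_equal.
  rewrite Rpower_mult. replace (r * (1 / r)) with 1 by (field; exact Hr).
  now apply Rpower_1.
Qed.

(** Homogeneity equates the defining equation at [(s, s^2)] with [s] times the
    one at [(1, s)]; eliminating the mean leaves only the weight. *)
Lemma weight_square P r s :
  r <> 0 -> weighted_by P (power_mean r) -> 0 < s < 1 ->
  P s * P s = P 1 * P (s * s).
Proof.
  intros Hr [HP HM] Hs.
  pose proof (HP 1 Rlt_0_1) as P1. pose proof (HP s (proj1 Hs)) as Ps.
  assert (Hss : 0 < s * s) by nra. pose proof (HP _ Hss) as Pss.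
  pose proof (power_mean_homogeneous r s 1 s Hr (proj1 Hs) Rlt_0_1 (proj1 Hs)) as E.
  rewrite Rmult_1_r, !HM in E by lra.
  apply (Rmult_eq_reg_l (s * (1 - s))); [|nra].
  apply (Rmult_eq_compat_r ((P s + P (s * s)) * (P 1 + P s))) in E.
  field_simplify in E; [|lra|lra]. nra.
Qed.

Lemma weight_ratio P M s :
  weighted_by P M -> 0 < s < 1 -> P s / P 1 = (1 - M 1 s) / (M 1 s - s).
Proof.
  intros [HP HM] Hs.
  pose proof (HP 1 Rlt_0_1) as P1. pose proof (HP s (proj1 Hs)) as Ps.
  rewrite HM by lra. field. repeat split; try lra. nra.
Qed.

(** * Asymptotics of the weight *)

Lemma is_lim_seq_exp_neg r :
  0 < r -> is_lim_seq (fun n => exp (- (r * INR n))) 0.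
Proof.
  intros Hr. apply (is_lim_comp_seq exp _ m_infty 0 is_lim_exp_m).
  - exists 0%nat. discriminate.
  - apply (is_lim_seq_opp _ p_infty).
    replace p_infty with (Rbar_mult r p_infty).
    + apply is_lim_seq_scal_l, is_lim_seq_INR.
    + simpl. destruct (Rle_dec 0 r) as [H|H]; [|lra].
      destruct (Rle_lt_or_eq_dec 0 r H); [reflexivity | lra].
Qed.

Lemma exp_neg_unit_interval n : (1 <= n)%nat -> 0 < exp (- INR n) < 1.
Proof.
  intros Hn. split; [apply exp_pos|]. rewrite <- exp_0. apply exp_increasing.
  apply le_INR in Hn. simpl in Hn. lra.
Qed.

Lemma power_mean_lim r :
  0 < r ->
  is_lim_seq (fun n => power_mean r 1 (exp (- INR n))) (Rpower (/ 2) (1 / r)).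
Proof.
  intros Hr.
  apply is_lim_seq_ext with
    (fun n => Rpower ((1 + exp (- (r * INR n))) / 2) (1 / r)).
  - intros n. rewrite power_mean_nonzero by lra.
    assert (E1 : Rpower 1 r = 1) by (unfold Rpower; now rewrite ln_1, Rmult_0_r, exp_0).
    assert (En : Rpower (exp (- INR n)) r = exp (- (r * INR n))).
    { unfold Rpower. rewrite ln_exp. f_equal. ring. }
    now rewrite E1, En.
  - apply (is_lim_seq_continuous (fun z => Rpower z (1 / r))).
    + apply derivable_continuous_pt. eexists. apply derivable_pt_lim_power. lra.
    + replace (/ 2) with ((1 + 0) / 2) by field.
      apply is_lim_seq_div'; [|apply is_lim_seq_const|lra].
      apply is_lim_seq_plus'; [apply is_lim_seq_const|].
      now apply is_lim_seq_exp_neg.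
Qed.

Lemma ln_half_neg : ln (/ 2) < 0.
Proof. rewrite <- ln_1. apply ln_increasing; lra. Qed.

Lemma Rpower_half_lt_1 t : 0 < t -> Rpower (/ 2) t < 1.
Proof.
  intros Ht. rewrite <- (Rpower_O (/ 2)) by lra. unfold Rpower.
  apply exp_increasing. pose proof ln_half_neg. nra.
Qed.

Lemma weight_ratio_lim P r :
  0 < r -> weighted_by P (power_mean r) ->
  is_lim_seq (fun n => P (exp (- INR n)) / P 1)
    ((1 - Rpower (/ 2) (1 / r)) / Rpower (/ 2) (1 / r)).
Proof.
  intros Hr HW.
  apply is_lim_seq_ext_loc with
    (fun n => (1 - power_mean r 1 (exp (- INR n)))
              / (power_mean r 1 (exp (- INR n)) - exp (- INR n))).
  - (* at [n = 0] the quotient is [0 / 0] *)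
    exists 1%nat. intros n Hn. symmetry. apply weight_ratio; [exact HW|].
    now apply exp_neg_unit_interval.
  - apply is_lim_seq_div'.
    + apply is_lim_seq_minus'; [apply is_lim_seq_const | now apply power_mean_lim].
    + replace (Rpower (/ 2) (1 / r)) with (Rpower (/ 2) (1 / r) - 0) by ring.
      apply is_lim_seq_minus'; [now apply power_mean_lim|].
      apply is_lim_seq_ext with (fun n => exp (- (1 * INR n))).
      * intros n. now rewrite Rmult_1_l.
      * apply is_lim_seq_exp_neg. lra.
    + apply Rgt_not_eq, Rpower_pos.
Qed.

(** The limit [q] of the normalised weight is idempotent and nonzero, and
    [q = 1] is an equation that determines [r]. *)
Lemma positive_exponent_one P r :
  0 < r -> weighted_by P (power_mean r) -> r = 1.
Proof.
  intros Hr HW.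
  pose proof (weight_ratio_lim P r Hr HW) as L.
  set (m := Rpower (/ 2) (1 / r)) in *.
  assert (Hm : 0 < m) by apply Rpower_pos.
  assert (Hi : 0 < 1 / r) by (apply Rdiv_lt_0_compat; lra).
  assert (Hm1 : m < 1) by now apply Rpower_half_lt_1.
  set (q := (1 - m) / m) in *.
  assert (Hq : 0 < q) by (apply Rdiv_lt_0_compat; lra).
  (* [exp (-2n)] is the square of [exp (-n)], so [P (exp (-2n)) / P 1] tends
     both to [q] and to [q * q] *)
  assert (L2 : is_lim_seq (fun n => P (exp (- INR (2 * n))) / P 1) q).
  { apply (is_lim_seq_subseq (fun n => P (exp (- INR n)) / P 1) q (fun n => 2 * n)%nat);
      [|exact L].
    apply eventually_subseq. intros n. lia. }
  pose proof (is_lim_seq_mult' _ _ _ _ L L) as L1.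
  apply is_lim_seq_ext_loc with (v := fun n => P (exp (- INR (2 * n))) / P 1) in L1.
  - apply is_lim_seq_unique in L1. apply is_lim_seq_unique in L2.
    rewrite L1 in L2. injection L2 as Eq.
    assert (Eq1 : q = 1) by (apply (Rmult_eq_reg_l q); lra).
    assert (Em : m = / 2).
    { assert (q * m = 1 - m) by (unfold q; field; lra). rewrite Eq1 in H. lra. }
    unfold m in Em. apply (f_equal ln) in Em. unfold Rpower in Em. rewrite ln_exp in Em.
    pose proof ln_half_neg.
    assert (E1 : 1 / r = 1) by (apply (Rmult_eq_reg_r (ln (/ 2))); lra).
    replace r with (/ (1 / r)) by (field; lra). rewrite E1. apply Rinv_1.
  - exists 1%nat. intros n Hn.
    pose proof (weight_square P r _ (Rgt_not_eq _ _ Hr) HW (exp_neg_unit_interval n Hn))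
      as E.
    rewrite <- exp_plus in E. rewrite mult_INR. simpl (INR 2).
    replace (- ((1 + 1) * INR n)) with (- INR n + - INR n) by ring.
    pose proof (proj1 HW 1 Rlt_0_1).
    replace (P (exp (- INR n)) / P 1 * (P (exp (- INR n)) / P 1))
      with ((P (exp (- INR n)) * P (exp (- INR n))) / (P 1 * P 1)) by (field; lra).
    rewrite E. field. lra.
Qed.

Lemma weighted_power_mean_exponent P r :
  weighted_by P (power_mean r) -> r = 1 \/ r = 0 \/ r = -1.
Proof.
  intros HW. destruct (Rtotal_order r 0) as [Hr|[Hr|Hr]].
  - right; right. apply power_mean_dual in HW; [|lra].
    apply positive_exponent_one in HW; lra.
  - now right; left.
  - left. now apply positive_exponent_one with P.
Qed.

Theorem theorem3p6 :
  (exists r : R, agree_pos (power_mean r) arithmetic_mean) /\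
  (exists r : R, agree_pos (power_mean r) geometric_mean) /\
  (exists r : R, agree_pos (power_mean r) harmonic_mean) /\
  (forall r : R,
     is_normal_mean (power_mean r) <->
     (agree_pos (power_mean r) arithmetic_mean \/
      agree_pos (power_mean r) geometric_mean \/
      agree_pos (power_mean r) harmonic_mean)).
Proof.
  split; [exists 1; exact power_mean_arithmetic|].
  split; [exists 0; exact power_mean_geometric|].
  split; [exists (-1); exact power_mean_harmonic|].
  intros r. split.
  - intros [_ [P [HP [_ HM]]]].
    destruct (weighted_power_mean_exponent P r (conj HP HM)) as [E|[E|E]]; subst r.
    + left. exact power_mean_arithmetic.
    + right; left. exact power_mean_geometric.
    + right; right. exact power_mean_harmonic.
  - intros [E|[E|E]].
    + now apply normal_arithmetic.
    + now apply normal_geometric.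
    + now apply normal_harmonic.
Qed.
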